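(* If $A\subset\mathbb R^n$ is inner $\alpha$-thin at infinity, then there exists a $K_\sigma$-set $A'\subset A$ such that $\gamma_{A'}$ exists, $\gamma_A=\gamma_{A'}$, and $A^r=(A')^r$.
   Context: Standing assumptions: $n\ge3$, $\alpha\in(0,2]$, and $\kappa_\alpha(x,y)=|x-y|^{\alpha-n}$ is the Riesz kernel on $\mathbb R^n$. $\mathfrak M^+$ denotes the cone of positive Radon measures $\mu$ on $\mathbb R^n$ whose potential $\kappa_\alpha\mu(x)=\int|x-z|^{\alpha-n}d\mu(z)$ is not identically $+\infty$. The energy of $\mu$ is $\|\mu\|_\alpha^2=\iint\kappa_\alpha\,d\mu\,d\mu$; $\mathcal E^+_\alpha(A)$ is the set of positive measures of finite energy concentrated on $A$. The inner capacity of $A\subset\mathbb R^n$ is defined by $1/c_\alpha(A)=\inf\{\|\mu\|_\alpha^2:\ \mu\in\mathcal E^+_\alpha(A),\ \mu(\mathbb R^n)=1\}$. ''n.e. on $A$'' means: for all points of $A$ except a subset of inner capacity zero. Inner balayage: for $\mu\in\mathfrak M^+$ and arbitrary $A$, $\mu^A$ is the unique measure in $\mathfrak M^+$ with $\kappa_\alpha\mu^A=\inf\{\kappa_\alpha\nu:\ \nu\in\mathfrak M^+,\ \kappa_\alpha\nu\ge\kappa_\alpha\mu \text{ n.e. on }A\}$ pointwise. $\varepsilon_y$ is the Dirac measure at $y$, $\varepsilon_y^A:=(\varepsilon_y)^A$, $A^r:=\{y:\ \varepsilon_y^A=\varepsilon_y\}$. Inner equilibrium measure: $\gamma_A$, if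 it exists, is the unique measure in $\mathfrak M^+$ with $\kappa_\alpha\gamma_A=\inf\{\kappa_\alpha\nu:\ \nu\in\mathfrak M^+,\ \kappa_\alpha\nu\ge1\text{ n.e. on }A\}$ pointwise. $A$ is called inner $\alpha$-thin at infinity if $\gamma_A$ exists. *)

(* Defs.v *)
From HB Require Import structures.
From mathcomp Require Import all_boot all_order all_algebra.
From mathcomp Require Import all_classical all_reals all_analysis.
Set Implicit Arguments. Unset Strict Implicit. Unset Printing Implicit Defensive.
Import Order.TTheory GRing.Theory Num.Theory.
Import numFieldNormedType.Exports.
Local Open Scope classical_set_scope.
Local Open Scope ring_scope.

Section Riesz.
Variables (R : realType) (n : nat) (alpha : R).

(* R^n, with the product (= Euclidean) topology of matrix_topology *)
Local Notation V := 'rV[R]_n.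

Definition BV := g_sigma_algebraType [set U : set V | open U].

Definition enorm (x : V) : R := Num.sqrt (\sum_(i < n) (x ord0 i) ^+ 2).

Definition kappa (x y : V) : \bar R :=
  if x == y then +oo%E else ((enorm (x - y)) `^ (alpha - n%:R))%:E.

Definition meas := {measure set BV -> \bar R}.

Definition pot (mu : meas) (x : V) : \bar R := (\int[mu]_(z in setT) kappa x z)%E.

Definition radon (mu : meas) : Prop :=
  forall K : set V, compact K -> (mu (K : set BV) < +oo)%E.

Definition Mplus (mu : meas) : Prop := radon mu /\ exists x, (pot mu x < +oo)%E.

Definition energy (mu : meas) : \bar R := (\int[mu]_(x in setT) pot mu x)%E.

Definition concentrated (mu : meas) (A : set V) : Prop :=
  mu.-negligible (~` A : set BV).

Definition Eplus (A : set V) (mu : meas) : Prop :=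
  Mplus mu /\ (energy mu < +oo)%E /\ concentrated mu A.

Definition inv_cap (A : set V) : \bar R :=
  ereal_inf [set energy mu | mu in [set mu | Eplus A mu /\ mu (setT : set BV) = 1%E]].

Definition cap_zero (A : set V) : Prop := inv_cap A = +oo%E.

Definition ne_on (A : set V) (P : V -> Prop) : Prop :=
  exists N : set V, N `<=` A /\ cap_zero N /\ forall x, A x -> ~ N x -> P x.

Definition is_balayage (mu : meas) (A : set V) (muA : meas) : Prop :=
  Mplus muA /\ forall x, pot muA x =
    ereal_inf [set pot nu x | nu in
      [set nu | Mplus nu /\ ne_on A (fun y => (pot mu y <= pot nu y)%E)]].

Definition regular_pts (A : set V) : set V :=
  [set y | is_balayage (@dirac _ BV y R) A (@dirac _ BV y R)].

Definition is_equilibrium (A : set V) (g : meas) : Prop :=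
  Mplus g /\ forall x, pot g x =
    ereal_inf [set pot nu x | nu in
      [set nu | Mplus nu /\ ne_on A (fun y => (1 <= pot nu y)%E)]].

Definition thin_at_infinity (A : set V) : Prop := exists g, is_equilibrium A g.

Definition Ksigma (A : set V) : Prop :=
  exists K : nat -> set V, (forall i, compact (K i)) /\ A = \bigcup_i K i.

End Riesz.

(* Main.v *)
Require Import Defs.
From HB Require Import structures.
From mathcomp Require Import all_boot all_order all_algebra.
From mathcomp Require Import all_classical all_reals all_analysis.
From mathcomp Require Import measurable_realfun ring lra.
Local Open Scope classical_set_scope.
Local Open Scope ring_scope.
Set Implicit Arguments. Unset Strict Implicit. Unset Printing Implicit Defensive.
Import Order.TTheory GRing.Theory Num.Theory.
Import numFieldNormedType.Exports.

(** Call a finite measure [l] carried by a compact set admissible if its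
    potential is bounded by a multiple of [(max 1 |x|)^(alpha - n)] and the
    integrals of the kernel over small balls are uniformly small.  With respect
    to the weighted uniform distance between potentials (and the difference of
    the total masses) the admissible measures carried by subsets of [A] form a
    separable space: they are approximated by discrete measures with rational
    data.  Let [A'] be the union of the compact carriers of a countable dense
    family.

    Let [nu] satisfy [pot nu >= f] n.e. on [A'], where [f] is [1] or a potential.
    If this failed on a subset [N] of [A] of positive capacity, a restriction of a
    measure of finite energy on [N] would be admissible and satisfy
    [int f dl > int pot nu dl].  By Tonelli, [int pot nu dl = int pot l dnu], so
    this strict inequality persists for a member of the dense family close to [l],
    although that measure is carried by [A'] and charges no set of zero capacity.
    Hence [A] and [A'] have the same competitors in the definitions of
    equilibrium and of balayage of Dirac measures. *)

(** * Euclidean norm and Borel sets of row vectors *)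

Section EuclideanNorm.
Context {R : realType} {n : nat}.
Local Notation V := 'rV[R]_n.
Implicit Types x y z : V.

Lemma enorm_ge0 x : 0 <= enorm x.
Proof. exact: sqrtr_ge0. Qed.

Lemma enorm_sqr x : enorm x ^+ 2 = \sum_(i < n) x ord0 i ^+ 2.
Proof. by rewrite sqr_sqrtr// sumr_ge0// => i _; exact: sqr_ge0. Qed.

Lemma enorm_eq0 x : (enorm x == 0) = (x == 0).
Proof.
apply/idP/idP => [/eqP x0|/eqP ->]; last first.
  by rewrite /enorm big1 ?sqrtr0// => i _; rewrite mxE expr0n.
apply/eqP/rowP => i; rewrite mxE; apply/eqP; rewrite -sqrf_eq0.
have := enorm_sqr x; rewrite x0 expr0n /= => /esym/eqP.
by rewrite psumr_eq0 => [/allP/(_ i (mem_index_enum _))//|j _]; exact: sqr_ge0.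
Qed.

Lemma enorm0 : enorm (0 : V) = 0.
Proof. by apply/eqP; rewrite enorm_eq0. Qed.

Lemma enormN x : enorm (- x) = enorm x.
Proof. by rewrite /enorm; under eq_bigr do rewrite mxE sqrrN. Qed.

Lemma enormC x y : enorm (x - y) = enorm (y - x).
Proof. by rewrite -enormN opprB. Qed.

Lemma dot_le_enorm x y :
  \sum_(i < n) x ord0 i * y ord0 i <= enorm x * enorm y.
Proof.
have [/eqP|x0] := eqVneq (enorm x) 0.
  rewrite enorm_eq0 => /eqP ->; rewrite enorm0 mul0r.
  by rewrite big1// => i _; rewrite mxE mul0r.
have [/eqP|y0] := eqVneq (enorm y) 0.
  rewrite enorm_eq0 => /eqP ->; rewrite enorm0 mulr0.
  by rewrite big1// => i _; rewrite mxE mulr0.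
set a := enorm x; set b := enorm y.
have a0 : 0 < a by rewrite lt_neqAle eq_sym x0 enorm_ge0.
have b0 : 0 < b by rewrite lt_neqAle eq_sym y0 enorm_ge0.
have : 0 <= \sum_(i < n) (b * x ord0 i - a * y ord0 i) ^+ 2.
  by apply: sumr_ge0 => i _; exact: sqr_ge0.
have -> : \sum_(i < n) (b * x ord0 i - a * y ord0 i) ^+ 2 =
   2 * a * b * (a * b - \sum_(i < n) x ord0 i * y ord0 i).
  rewrite (eq_bigr (fun i => b ^+ 2 * x ord0 i ^+ 2 +
    (a ^+ 2 * y ord0 i ^+ 2 - 2 * a * b * (x ord0 i * y ord0 i)))); last first.
    by move=> i _; ring.
  rewrite big_split/= sumrB -!mulr_sumr -!enorm_sqr -/a -/b; ring.
by rewrite pmulr_rge0 ?subr_ge0// !mulr_gt0.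
Qed.

Lemma enormD x y : enorm (x + y) <= enorm x + enorm y.
Proof.
rewrite -(@ler_pXn2r _ 2)// ?nnegrE ?addr_ge0 ?enorm_ge0//.
have -> : enorm (x + y) ^+ 2 = enorm x ^+ 2 + enorm y ^+ 2 +
    2 * \sum_(i < n) x ord0 i * y ord0 i.
  rewrite !enorm_sqr mulr_sumr -!big_split/=; apply: eq_bigr => i _.
  by rewrite mxE; ring.
by have := dot_le_enorm x y; nra.
Qed.

Lemma enorm_dist y x z : enorm (x - z) <= enorm (x - y) + enorm (y - z).
Proof. by rewrite (le_trans _ (enormD _ _))// addrA subrK. Qed.

Lemma enorm_le_mx x : enorm x <= n%:R * `|x|.
Proof.
have xi i : `|x ord0 i| <= `|x|.
  rewrite [leRHS]/Num.norm /= mx_normrE.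
  by apply: (le_bigmax _ (fun i => `|x i.1 i.2|) (ord0, i)).
rewrite -(@ler_pXn2r _ 2)// ?nnegrE ?enorm_ge0 ?mulr_ge0//.
rewrite enorm_sqr; apply: (@le_trans _ _ (\sum_(i < n) `|x| ^+ 2)).
  apply: ler_sum => i _; rewrite -[leLHS]real_normK ?num_real//.
  by rewrite lerXn2r ?nnegrE.
rewrite sumr_const card_ord -[leLHS]mulr_natl exprMn.
rewrite ler_wpM2r ?sqr_ge0// -natrX ler_nat.
by rewrite -mulnn; have [->//|n0] := posnP n; rewrite leq_pmulr.
Qed.

Lemma coord_le_enorm x i : `|x ord0 i| <= enorm x.
Proof.
rewrite -(@ler_pXn2r _ 2)// ?nnegrE ?enorm_ge0// enorm_sqr real_normK ?num_real//.
rewrite (bigD1 i)//= lerDl; apply: sumr_ge0 => j _; exact: sqr_ge0.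
Qed.

Lemma mx_le_enorm x : `|x| <= enorm x.
Proof.
rewrite [leLHS]/Num.norm /= mx_normrE; apply: bigmax_le; first exact: enorm_ge0.
by move=> [i j] _ /=; rewrite ord1; exact: coord_le_enorm.
Qed.

End EuclideanNorm.

Section BorelSpace.
Context {R : realType} {n : nat}.
Local Notation V := 'rV[R]_n.
Local Notation B := (BV R n).

Lemma open_measurable_BV (U : set V) : open U -> measurable (U : set B).
Proof. by move=> oU; exact: sub_sigma_algebra. Qed.

Lemma closed_measurable_BV (U : set V) : closed U -> measurable (U : set B).
Proof.
move=> cU; rewrite -[U]setCK; apply: measurableC.
by apply: open_measurable_BV; exact: closed_openC.
Qed.

Lemma compact_measurable_BV (U : set V) : compact U -> measurable (U : set B).
Proof.
by move=> cU; apply: closed_measurable_BV; exact: compact_closed.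
Qed.

Lemma measurable_coord i : measurable_fun setT (fun x : B => (x : V) ord0 i).
Proof.
apply: (measurability _ (RGenOInfty.measurableE R)) => _ [_ [a ->] <-].
rewrite setTI; apply: open_measurable_BV; apply: open_comp => [x _|].
  exact: coord_continuous.
exact: interval_open.
Qed.

Lemma measurable_enorm_sub {d} {T : measurableType d} (f g : T -> B) :
  measurable_fun setT f -> measurable_fun setT g ->
  measurable_fun setT (fun t => enorm ((f t : V) - (g t : V))).
Proof.
move=> mf mg; rewrite /enorm.
apply: (measurableT_comp (continuous_measurable_fun (@sqrt_continuous R))).
apply: measurable_sum => i.
apply: measurable_funX.
under eq_fun do rewrite !mxE.
apply: measurable_funB.
  exact: (measurableT_comp (measurable_coord i) mf).
exact: (measurableT_comp (measurable_coord i) mg).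
Qed.
End BorelSpace.

(** * Truncations of the Riesz kernel *)

Section Kernels.
Context {R : realType} {n : nat} (alpha : R).
Hypothesis alpha_lt_n : alpha < n%:R.
Local Notation V := 'rV[R]_n.
Local Notation B := (BV R n).
Local Notation k := (kappa alpha).
Local Notation g := (alpha - n%:R).
Implicit Types x y z : V.

Definition tker (e : R) x z : R := Num.max (enorm (x - z)) e `^ g.

Definition nker (e : R) x z : \bar R := if enorm (x - z) < e then k x z else 0%E.

(* The decay at infinity of potentials of compactly supported measures; it is
   integrable for every measure in [Mplus]. *)
Definition wt x : R := tker 1 x 0.

Lemma powR_homogeneous (a b c : R) : 0 < a -> 0 < b -> 0 < c -> a <= c * b ->
  b `^ g <= c `^ (- g) * a `^ g.
Proof.
move=> a0 b0 c0 abc; have g0 : 0 <= - g by rewrite oppr_ge0 subr_le0 ltW.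
have E t : t `^ g = (t `^ (- g))^-1 by rewrite -powRN opprK.
rewrite !E ler_pdivlMr ?powR_gt0// mulrC ler_pdivrMr ?powR_gt0//.
rewrite -powRM; [|exact: ltW..]; apply: ge0_ler_powR; rewrite // nnegrE ?mulr_ge0// ltW//.
Qed.

Lemma powR_anti (a b : R) : 0 < a -> a <= b -> b `^ g <= a `^ g.
Proof.
move=> a0 ab; have := @powR_homogeneous a b 1 a0 (lt_le_trans a0 ab) ltr01.
by rewrite mul1r powR1 mul1r; apply.
Qed.

Lemma tker_gt0 e x z : 0 < e -> 0 < tker e x z.
Proof. by move=> e0; rewrite powR_gt0// lt_max e0 orbT. Qed.

Lemma wt_gt0 x : 0 < wt x. Proof. exact: tker_gt0. Qed.

Lemma wt_le1 x : wt x <= 1.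
Proof.
have <- : 1 `^ g = 1 by rewrite powR1.
by apply: powR_anti => //; rewrite le_max lexx orbT.
Qed.

Lemma kappa_ge0 x z : (0 <= k x z)%E.
Proof. by rewrite /kappa; case: ifPn => // _; rewrite lee_fin powR_ge0. Qed.

Lemma nker_ge0 e x z : (0 <= nker e x z)%E.
Proof. by rewrite /nker; case: ifPn => // _; exact: kappa_ge0. Qed.

Lemma kappaC x z : k x z = k z x.
Proof. by rewrite /kappa eq_sym enormC. Qed.

Lemma enorm_sub_gt0 x z : x != z -> 0 < enorm (x - z).
Proof. by move=> xz; rewrite lt_neqAle enorm_ge0 eq_sym enorm_eq0 subr_eq0 xz. Qed.

Lemma tker_le_kappa e x z : 0 < e -> ((tker e x z)%:E <= k x z)%E.
Proof.
move=> e0; rewrite /kappa; case: ifPn => [_|xz]; first exact: leey.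
by rewrite lee_fin powR_anti ?enorm_sub_gt0// le_max lexx.
Qed.

Lemma kappa_le_nker_tker e x z : 0 < e ->
  (k x z <= nker e x z + (tker e x z)%:E)%E.
Proof.
move=> e0; rewrite /nker; case: ltP => [_|xz].
  by rewrite leeDl// lee_fin powR_ge0.
rewrite add0e /kappa ifF /tker ?(max_idPl xz)//.
by apply: contraTF xz => /eqP ->; rewrite subrr enorm0 -ltNge.
Qed.

Lemma kappa_dilation c x x' z : 0 < c -> enorm (x' - z) <= c * enorm (x - z) ->
  (k x z <= (c `^ (- g))%:E * k x' z)%E.
Proof.
move=> c0 xz; have [->|x'z] := eqVneq x' z.
  by rewrite /kappa eqxx gt0_muley ?leey// lte_fin powR_gt0.
have x'z0 := enorm_sub_gt0 x'z.
have xz0 : 0 < enorm (x - z) by rewrite -(pmulr_rgt0 _ c0) (lt_le_trans x'z0).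
rewrite /kappa (negbTE x'z) ifF; first by rewrite lee_fin powR_homogeneous.
by apply: contraTF xz0 => /eqP ->; rewrite subrr enorm0 ltxx.
Qed.

Lemma nker_dilation c e x x' z : 0 < c -> enorm (x' - z) <= c * enorm (x - z) ->
  (nker e x z <= (c `^ (- g))%:E * nker (c * e) x' z)%E.
Proof.
move=> c0 xz; rewrite /nker; case: ltP => [xe|_].
  by rewrite (le_lt_trans xz) ?ltr_pM2l//; exact: kappa_dilation.
by rewrite mule_ge0// ?lee_fin ?powR_ge0//; case: ifPn => // _; exact: kappa_ge0.
Qed.

Lemma tker_near e r x z z' : 0 < e -> 0 <= r -> enorm (z - z') <= r ->
  tker e x z <= (1 + r / e) `^ (- g) * tker e x z'.
Proof.
move=> e0 r0 zz'; apply: powR_homogeneous; rewrite ?lt_max ?e0 ?orbT//.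
  by rewrite ltr_pwDl// divr_ge0// ltW.
have xz : enorm (x - z') <= enorm (x - z) + r.
  by rewrite (le_trans (enorm_dist z _ _))// lerD2l.
set m := Num.max (enorm (x - z)) e.
have m1 : enorm (x - z) <= m by rewrite le_max lexx.
have m2 : e <= m by rewrite le_max lexx orbT.
have : r <= r / e * m by rewrite -mulrA ler_peMr// mulrC ler_pdivlMr// mul1r.
by rewrite ge_max mulrDl mul1r; lra.
Qed.

Lemma wt_le_kappa x y : ((wt x)%:E <= ((1 + enorm y) `^ (- g))%:E * k x y)%E.
Proof.
have c0 : 0 < 1 + enorm y by rewrite ltr_pwDl// enorm_ge0.
rewrite /kappa; case: ifPn => [_|xy].
  by rewrite gt0_muley ?leey// lte_fin powR_gt0.
rewrite lee_fin; apply: powR_homogeneous => //; first exact: enorm_sub_gt0.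
  by rewrite lt_max ltr01 orbT.
rewrite subr0; set m := Num.max _ _.
have m1 : enorm x <= m by rewrite le_max lexx.
have m2 : 1 <= m by rewrite le_max lexx orbT.
have := @enormD _ _ x (- y); rewrite enormN; have := enorm_ge0 y; nra.
Qed.

Lemma tker_le_wt e r x z : 0 < e -> enorm z <= r ->
  tker e x z <= (1 + (r + 1) / e) `^ (- g) * wt x.
Proof.
move=> e0 zr; have r0 : 0 <= r := le_trans (enorm_ge0 z) zr.
apply: powR_homogeneous; rewrite ?lt_max ?ltr01 ?e0 ?orbT//.
  by rewrite ltr_pwDl// divr_ge0 ?ltW// ltr_wpDl.
have xz : enorm (x - 0) <= enorm (x - z) + r.
  by rewrite (le_trans (enorm_dist z _ _))// lerD2l subr0.
set m := Num.max (enorm (x - z)) e.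
have m1 : enorm (x - z) <= m by rewrite le_max lexx.
have m2 : e <= m by rewrite le_max lexx orbT.
have m0 : 0 < m by exact: lt_le_trans m2.
have : r + 1 <= (r + 1) / e * m.
  by rewrite -mulrA ler_peMr ?addr_ge0// mulrC ler_pdivlMr// mul1r.
by rewrite ge_max mulrDl mul1r; move: xz; lra.
Qed.

Lemma measurable_tker {d} {T : measurableType d} e (f h : T -> B) :
  measurable_fun setT f -> measurable_fun setT h ->
  measurable_fun setT (fun t => (tker e (f t) (h t))%:E).
Proof.
move=> mf mh; apply/measurable_EFinP.
apply: (measurableT_comp (measurable_powR _)).
by apply: measurable_maxr => //; exact: measurable_enorm_sub.
Qed.

Lemma measurable_kappa {d} {T : measurableType d} (f h : T -> B) :
  measurable_fun setT f -> measurable_fun setT h ->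
  measurable_fun setT (fun t => k (f t) (h t)).
Proof.
move=> mf mh; have mE := measurable_enorm_sub mf mh.
rewrite (_ : (fun _ => _) = fun t => if enorm ((f t : V) - (h t : V)) <= 0
    then +oo%E else (enorm ((f t : V) - (h t : V)) `^ g)%:E).
  apply: measurable_fun_ifT => //; first exact: measurable_fun_ler.
  exact/measurable_EFinP/(measurableT_comp (measurable_powR _)).
apply/funext => t; rewrite /kappa.
by rewrite -subr_eq0 -enorm_eq0 eq_le enorm_ge0 andbT.
Qed.

Lemma measurable_nker {d} {T : measurableType d} e (f h : T -> B) :
  measurable_fun setT f -> measurable_fun setT h ->
  measurable_fun setT (fun t => nker e (f t) (h t)).
Proof.
move=> mf mh; apply: measurable_fun_ifT => //; last exact: measurable_kappa.
by apply: measurable_fun_ltr => //; exact: measurable_enorm_sub.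
Qed.

End Kernels.

(** * Potentials *)

Definition sigma_finite_copy {d} {T : measurableType d} {R : realType}
  (m : {measure set T -> \bar R}) of sigma_finite setT m : set T -> \bar R := m.

Section SigmaFiniteCopy.
Context {d} {T : measurableType d} {R : realType}.
Context (m : {measure set T -> \bar R}) (H : sigma_finite setT m).

HB.instance Definition _ := Measure.copy (sigma_finite_copy H) m.
HB.instance Definition _ :=
  @Measure_isSigmaFinite.Build d T R (sigma_finite_copy H) H.

Lemma sigma_finite_measureP :
  exists m' : {sigma_finite_measure set T -> \bar R},
    m' = m :> (set T -> \bar R).
Proof. by exists (sigma_finite_copy H). Qed.

End SigmaFiniteCopy.

Lemma measurable_kernel_integral {d} {T : measurableType d} {R : realType}
    (K : T -> T -> \bar R) (nu : {measure set T -> \bar R}) :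
  sigma_finite setT nu -> measurable_fun setT (fun p : T * T => K p.1 p.2) ->
  (forall x z, 0 <= K x z)%E ->
  measurable_fun setT (fun x => \int[nu]_(z in setT) K x z)%E.
Proof.
move=> /sigma_finite_measureP[m <-] mK K0.
pose f p := K p.1 p.2; have f0 p : (0 <= f p)%E by exact: K0.
exact: (@measurable_fun_fubini_tonelli_F _ _ T T R m f mK f0).
Qed.

Lemma kernel_integralC {d} {T : measurableType d} {R : realType}
    (K : T -> T -> \bar R) (mu nu : {measure set T -> \bar R}) :
  sigma_finite setT mu -> sigma_finite setT nu ->
  measurable_fun setT (fun p : T * T => K p.1 p.2) ->
  (forall x z, 0 <= K x z)%E -> (forall x z, K x z = K z x) ->
  (\int[mu]_(x in setT) \int[nu]_(z in setT) K x z =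
   \int[nu]_(x in setT) \int[mu]_(z in setT) K x z)%E.
Proof.
move=> /sigma_finite_measureP[m <-] /sigma_finite_measureP[m' <-] mK K0 KC.
pose f p := K p.1 p.2; have f0 p : (0 <= f p)%E by exact: K0.
rewrite (@fubini_tonelli _ _ _ _ _ m m' f mK f0).
by apply: eq_integral => x _; apply: eq_integral => z _; rewrite /= KC.
Qed.

Section Potentials.
Context {R : realType} {n : nat} (alpha : R).
Hypothesis alpha_lt_n : alpha < n%:R.
Local Notation V := 'rV[R]_n.
Local Notation B := (BV R n).
Local Notation k := (kappa alpha).
Local Notation g := (alpha - n%:R).
Implicit Types (x y z : V) (nu mu l : meas R n).

Lemma compact_norm_le (r : R) : compact [set x : V | `|x| <= r].
Proof.
apply: bounded_closed_compact.
  exists r; split; first exact: num_real.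
  by move=> M rM x /= /le_trans; apply; exact: ltW.
rewrite (_ : [set x | _] = (fun x : V => `|x|) @^-1` [set t | t <= r]).
  apply: closed_comp => [x _|]; first exact: norm_continuous.
  exact: closed_le.
by [].
Qed.

Lemma radon_sigma_finite nu : radon nu -> sigma_finite setT nu.
Proof.
move=> rnu; exists (fun m => [set x : V | `|x| <= m%:R]).
  apply/esym; rewrite -subTset => x _.
  by exists (Num.trunc `|x|).+1 => //=; rewrite ltW// truncnS_gt.
move=> m; split; last by apply: rnu; exact: compact_norm_le.
by apply: compact_measurable_BV; exact: compact_norm_le.
Qed.

Lemma measurable_kappal x : measurable_fun setT (fun z : B => k x (z : V)).
Proof. by apply: measurable_kappa => //; exact: measurable_cst. Qed.

Lemma measurable_nkerl e x :
  measurable_fun setT (fun z : B => nker alpha e x (z : V)).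
Proof. by apply: measurable_nker => //; exact: measurable_cst. Qed.

Lemma measurable_tkerl e x :
  measurable_fun setT (fun z : B => (tker alpha e x (z : V))%:E).
Proof. by apply: measurable_tker => //; exact: measurable_cst. Qed.

Lemma measurable_wt : measurable_fun setT (fun z : B => (wt alpha (z : V))%:E).
Proof. by apply: measurable_tker => //; exact: measurable_cst. Qed.

Lemma pot_ge0 nu x : (0 <= pot alpha nu x)%E.
Proof. by apply: integral_ge0 => z _; exact: kappa_ge0. Qed.

Lemma pot_dirac y x : pot alpha (@dirac _ B y R) x = k x y.
Proof.
rewrite /pot integral_dirac//; last exact: measurable_kappal.
by rewrite diracT mul1e.
Qed.

Lemma measurable_pot nu : radon nu ->
  measurable_fun setT (pot alpha nu : B -> \bar R).
Proof.
move=> rnu; apply: (@measurable_kernel_integral _ B R k nu).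
- exact: radon_sigma_finite.
- by apply: (@measurable_kappa R n alpha _ (B * B)%type fst snd).
- exact: kappa_ge0.
Qed.

Lemma integral_potC mu nu : radon mu -> radon nu ->
  (\int[mu]_(x in setT) pot alpha nu x = \int[nu]_(x in setT) pot alpha mu x)%E.
Proof.
move=> rmu rnu; apply: (@kernel_integralC _ B R k mu nu).
- exact: radon_sigma_finite.
- exact: radon_sigma_finite.
- by apply: (@measurable_kappa R n alpha _ (B * B)%type fst snd).
- exact: kappa_ge0.
- exact: kappaC.
Qed.

Lemma integral_wt_lty nu : Mplus alpha nu ->
  (\int[nu]_(z in setT) (wt alpha z)%:E < +oo)%E.
Proof.
move=> [_ [x fx]].
apply: (@le_lt_trans _ _ (((1 + enorm x) `^ (- g))%:E * pot alpha nu x)%E).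
  rewrite /pot -ge0_integralZl//; first last.
  - by rewrite lee_fin powR_ge0.
  - by move=> z _; exact: kappa_ge0.
  - exact: measurable_kappal.
  apply: ge0_le_integral => //.
  - by move=> z _; rewrite lee_fin ltW// wt_gt0.
  - exact: measurable_wt.
  - by apply: emeasurable_funM => //; exact: measurable_kappal.
  - by move=> z _; rewrite kappaC; exact: wt_le_kappa.
by rewrite lte_mul_pinfty ?lee_fin ?powR_ge0.
Qed.

Lemma pot_le_measure l mu : (forall E : set B, measurable E -> l E <= mu E)%E ->
  forall x, (pot alpha l x <= pot alpha mu x)%E.
Proof.
move=> H x; apply: ge0_le_measure_integral => //.
  by move=> z; exact: kappa_ge0.
exact: measurable_kappal.
Qed.

Lemma Mplus_dirac y : (0 < n)%N -> Mplus alpha (@dirac _ B y R).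
Proof.
move=> n0; split.
  by move=> K _; rewrite /= diracE ltry.
exists (y + const_mx 1); rewrite pot_dirac /kappa ifF ?ltry//.
apply/negP; rewrite -subr_eq0 addrAC subrr add0r => /eqP/rowP/(_ (Ordinal n0)).
by rewrite !mxE => /eqP; rewrite oner_eq0.
Qed.

End Potentials.

(** * Inner regularity of finite Borel measures *)

Lemma measure_nonincreasing_lt {d} {T : measurableType d} {R : realType}
    (mu : {measure set T -> \bar R}) (F : nat -> set T) (e : \bar R) :
  (mu (F 0%N) < +oo)%E -> (forall i, measurable (F i)) ->
  (forall i, F i.+1 `<=` F i) -> (mu (\bigcap_i F i) < e)%E ->
  exists i, (mu (F i) < e)%E.
Proof.
move=> F0 mF dF Fe.
have dF' : {homo F : i j / (i <= j)%N >-> (j <= i)%O}.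
  by apply/nonincreasing_seqP => i; apply/subsetPset.
have cF := @nonincreasing_cvg_mu _ _ _ mu F F0 mF (bigcapT_measurable mF) dF'.
apply: contrapT => H; move: Fe; apply/negP; rewrite -leNgt.
rewrite -(cvg_lim (@ereal_hausdorff R) cF); apply: lime_ge.
  exact: cvgP cF.
by apply: nearW => i /=; rewrite leNgt; apply/negP => Fi; apply: H; exists i.
Qed.

Section InnerRegularity.
Context {R : realType} {n : nat}.
Local Notation V := 'rV[R]_n.
Local Notation B := (BV R n).
Variable mu : {measure set B -> \bar R}.
Hypothesis mu_fin : (mu setT < +oo)%E.

Definition regular_set : set (set V) := [set E | forall e : R, 0 < e ->
  exists C U : set V, [/\ closed C, open U, C `<=` E, E `<=` U &
    (mu (U `\` C : set B) < e%:E)%E]].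

Lemma measure_lty (E : set B) : measurable E -> (mu E < +oo)%E.
Proof. by move=> mE; rewrite (le_lt_trans _ mu_fin)// le_measure ?inE. Qed.

Lemma measurable_open_closedD (U C : set V) : open U -> closed C ->
  measurable (U `\` C : set B).
Proof.
move=> oU cC; apply: (@measurableD _ B U C); first exact: open_measurable_BV.
exact: closed_measurable_BV.
Qed.

Lemma open_regular_set (U : set V) : open U -> regular_set U.
Proof.
move=> oU e e0.
pose C m := ~` \bigcup_(y in ~` U) ball y (m.+1%:R^-1 : R).
have cC m : closed (C m).
  by apply: open_closedC; apply: bigcup_open => y _; exact: ball_open.
have CU m : C m `<=` U.
  move=> x Cx; apply: contrapT => Ux; apply: Cx; exists x => //.
  by apply: ballxx; rewrite invr_gt0.
have [] := @measure_nonincreasing_lt _ B R mu (fun m => U `\` C m) e%:E.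
- by apply: measure_lty; exact: measurable_open_closedD.
- by move=> i; exact: measurable_open_closedD.
- move=> i x [Ux Cx]; split => // Cix; apply: Cx => -[y Uy yx].
  apply: Cix; exists y => //; apply: le_ball yx.
  by rewrite lef_pV2 ?posrE ?ltr0Sn// ler_nat.
- rewrite (_ : \bigcap_i _ = set0) ?measure0// -subset0 => x UCx.
  have Ux : U x by have [] := UCx 0%N Logic.I.
  have /nbhs_ballP[r /= r0 rU] := open_nbhs_nbhs (conj oU Ux).
  have [m _ mr] := near_infty_natSinv_lt (PosNum r0).
  have [_ /contrapT[y Uy yx]] := UCx m Logic.I; apply: Uy; apply: rU.
  by apply: ball_sym; apply: le_ball yx; have /= /ltW := mr m (leqnn m).
- by move=> m mU; exists (C m), U; split.
Qed.

Lemma setC_regular_set (E : set V) : regular_set E -> regular_set (~` E).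
Proof.
move=> H e /H [C [U [cC oU CE EU CUe]]]; exists (~` U), (~` C).
split; [exact: open_closedC|exact: closed_openC|exact: subsetC|exact: subsetC|].
by rewrite setDE setCK setIC -setDE.
Qed.

Lemma bigcup_regular_set (E : (set V)^nat) : (forall i, regular_set (E i)) ->
  regular_set (\bigcup_i E i).
Proof.
move=> H e e0; have e2 : 0 < e / 2 by rewrite divr_gt0.
have e3 i : 0 < e / 2 / (2 ^ i.+1)%:R by rewrite divr_gt0// ltr0n expn_gt0.
have /choice[C /choice[U CU]] := fun i => H i _ (e3 i).
have oU : open (\bigcup_i U i) by apply: bigcup_open => i _; have [] := CU i.
have cC m : closed (\bigcup_(i in `I_m) C i).
  by apply: closed_bigcup => // i _; have [] := CU i.
have mUC i : measurable (U i `\` C i : set B).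
  by apply: measurable_open_closedD; have [] := CU i.
have mF m : measurable (\bigcup_i U i `\` \bigcup_(i in `I_m) C i : set B).
  exact: measurable_open_closedD.
have [] := @measure_nonincreasing_lt _ B R mu
  (fun m => \bigcup_i U i `\` \bigcup_(i in `I_m) C i) e%:E.
- exact: measure_lty.
- exact: mF.
- move=> m x [Ux Cx]; split => // -[i im Cix]; apply: Cx; exists i => //.
  exact: leqW.
- apply: (@le_lt_trans _ _ (e / 2)%:E); last first.
    by rewrite lte_fin ltr_pdivrMr// ltr_pMr// ltr1n.
  apply: le_trans (epsilon_trick0 xpredT (ltW e2)).
  apply: (@le_trans _ _ (\sum_(0 <= i <oo) mu (U i `\` C i : set B)))%E.
    apply: measure_sigma_subadditive => //; first exact: bigcapT_measurable.
    move=> x UCx; have [[i _ Uix] _] := UCx 0%N Logic.I.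
    by exists i => //; split => // Cix; have [_] := UCx i.+1 Logic.I; apply; exists i => /=.
  by apply: lee_nneseries => // i _; apply/ltW; have [] := CU i.
- move=> m mUC'; exists (\bigcup_(i in `I_m) C i), (\bigcup_i U i); split => //.
  + by move=> x [i _ Cx]; exists i => //; have [_ _ + _ _] := CU i; exact.
  + by move=> x [i _ Ex]; exists i => //; have [_ _ _ + _] := CU i; exact.
Qed.

Lemma measurable_regular_set (E : set B) : measurable E -> regular_set E.
Proof.
apply: smallest_sub; last exact: open_regular_set.
split.
- by apply: open_regular_set; exact: open0.
- by move=> A rA; rewrite setTD; exact: setC_regular_set.
- exact: bigcup_regular_set.
Qed.

Lemma inner_regular_pos (E : set B) : measurable E -> (0 < mu E)%E ->
  exists K : set V, [/\ compact K, K `<=` E & (0 < mu (K : set B))%E].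
Proof.
move=> mE E0; have Efin := measure_lty mE.
have fE0 : 0 < fine (mu E) by rewrite fine_gt0// E0.
have [C [U [cC oU CE EU CUe]]] := measurable_regular_set mE fE0.
have mC := closed_measurable_BV cC.
have C0 : (0 < mu (C : set B))%E.
  rewrite lt_neqAle measure_ge0 andbT eq_sym; apply/eqP => C0.
  have : (mu E <= mu (C : set B) + mu (U `\` C : set B))%E.
    apply: (le_trans _ (measureU2 _ _ _)) => //.
      rewrite le_measure ?inE//; first apply: measurableU => //.
        exact: measurable_open_closedD.
      by move=> x Ex; have [Cx|Cx] := pselect (C x); [left|right; split => //; exact: EU].
    exact: measurable_open_closedD.
  rewrite C0 add0e => /le_lt_trans/(_ CUe); rewrite fineK ?ltxx//.
  by rewrite ge0_fin_numE.
apply: contrapT => H.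
pose K m := C `&` [set x : V | `|x| <= m%:R].
have cK m : compact (K m).
  rewrite /K setIC; apply: compact_closedI => //; exact: compact_norm_le.
have K0 m : mu (K m : set B) = 0%E.
  apply/eqP; rewrite eq_le measure_ge0 andbT leNgt; apply/negP => K0; apply: H.
  by exists (K m); split => // x [Cx _]; exact: CE.
have : mu.-negligible (C : set B).
  have <- : \bigcup_m K m = C.
    apply/seteqP; split => [x [m _ []]//|x Cx].
    by exists (Num.trunc `|x|).+1 => //; split => //=; rewrite ltW// truncnS_gt.
  apply: negligible_bigcup => m; apply/negligibleP; last exact: K0.
  by apply: compact_measurable_BV; exact: cK.
by move=> /negligibleP => /(_ mC) C00; rewrite C00 ltxx in C0.
Qed.

End InnerRegularity.

(** * Discretisation of admissible measures *)

Section RationalPoints.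
Context {R : realType} {n : nat}.
Local Notation V := 'rV[R]_n.

Definition ratpt (j : nat) : V :=
  if unpickle j is Some v then map_mx ratr (v : 'rV[rat]_n) else 0.

Lemma ratpt_dense (x : V) (r : R) : 0 < r -> exists j, ball (ratpt j) r x.
Proof.
move=> r0.
have /choice[v xv] (i : 'I_n) : exists q : rat, ratr q \in `]x ord0 i, x ord0 i + r[.
  by apply: rat_in_itvoo; rewrite ltrDl.
exists (pickle (\row_i v i)); rewrite /ratpt pickleK; split => // i j.
rewrite ord1 !mxE /ball /=; have := xv j; rewrite in_itv/= => /andP[xq qx].
by rewrite gtr0_norm ?subr_gt0// ltrBlDl.
Qed.

Lemma compact_ratpt_cover (K : set V) (r : R) : compact K -> 0 < r ->
  exists J, K `<=` \big[setU/set0]_(j < J) ball (ratpt j) r.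
Proof.
move=> cK r0; move: cK; rewrite compact_cover => /(_ nat setT (fun j => ball (ratpt j) r)).
case => [j _|x Kx|D _ KD].
- exact: ball_open.
- by have [j xj] := ratpt_dense x r0; exists j.
exists (\max_(j <- finmap.enum_fset D) j).+1 => x /KD[j /= jD xj].
rewrite -(bigcup_mkord _ (fun j => ball (ratpt j) r)); exists j => //=; rewrite ltnS.
by apply: (@leq_bigmax_seq _ _ xpredT id).
Qed.

End RationalPoints.

Section Discretisation.
Context {R : realType} {n : nat} (alpha : R).
Hypothesis alpha_lt_n : alpha < n%:R.
Local Notation V := 'rV[R]_n.
Local Notation B := (BV R n).
Local Notation k := (kappa alpha).
Local Notation g := (alpha - n%:R).
Local Notation wt := (wt alpha).
Implicit Types (x y z : V) (nu mu l : meas R n) (K : set V).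

Definition admissible l K := [/\ compact K, l (~` K : set B) = 0%E,
  (l setT < +oo)%E,
  exists M : R, forall x, (pot alpha l x <= (M * wt x)%:E)%E &
  forall d : R, 0 < d -> exists e : nat, forall x,
    (\int[l]_(z in setT) nker alpha e.+1%:R^-1 x z <= (d * wt x)%:E)%E].

Lemma le_pot_nker_tker e l x : 0 < e -> (pot alpha l x <=
  \int[l]_(z in setT) nker alpha e x z +
  \int[l]_(z in setT) (tker alpha e x z)%:E)%E.
Proof.
move=> e0; rewrite -ge0_integralD//.
- apply: ge0_le_integral => //.
  + by move=> z _; exact: kappa_ge0.
  + exact: measurable_kappal.
  + apply: emeasurable_funD; first exact: measurable_nkerl.
    exact: measurable_tkerl.
  + by move=> z _; exact: kappa_le_nker_tker.
- by move=> z _; exact: nker_ge0.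
- exact: measurable_nkerl.
- by move=> z _; rewrite lee_fin powR_ge0.
- exact: measurable_tkerl.
Qed.

Lemma integral_tker_le_pot e l x : 0 < e ->
  (\int[l]_(z in setT) (tker alpha e x z)%:E <= pot alpha l x)%E.
Proof.
move=> e0; apply: ge0_le_integral => //.
- by move=> z _; rewrite lee_fin powR_ge0.
- exact: measurable_tkerl.
- exact: measurable_kappal.
- by move=> z _; exact: tker_le_kappa.
Qed.

Lemma integral_tker_piece e r l x y (Q : set B) (a : R) : 0 < e -> 0 <= r ->
  measurable Q -> (forall z, Q z -> enorm (z - y) <= r) -> l Q = a%:E ->
  let th := (1 + r / e) `^ (- g) in
  (\int[l]_(z in Q) (tker alpha e x z)%:E <= (th * (a * tker alpha e x y))%:E)%E /\
  ((a * tker alpha e x y)%:E <= th%:E * \int[l]_(z in Q) (tker alpha e x z)%:E)%E.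
Proof.
move=> e0 r0 mQ Qy lQ th; have th0 : 0 <= th by exact: powR_ge0.
have mt : measurable_fun Q (fun z : B => (tker alpha e x (z : V))%:E).
  by apply: measurable_funTS; exact: measurable_tkerl.
have t0 y' z : 0 <= tker alpha e y' z by exact: powR_ge0.
split.
- apply: (@le_trans _ _ (\int[l]_(z in Q) (th * tker alpha e x y)%:E)%E).
    apply: ge0_le_integral => //.
      by move=> z _; rewrite lee_fin.
    by move=> z Qz; rewrite lee_fin; apply: tker_near => //; exact: Qy.
  by rewrite integral_cst//= lQ -EFinM mulrAC mulrA.
- rewrite -ge0_integralZl//; last by move=> z _; rewrite lee_fin.
  apply: (@le_trans _ _ (\int[l]_(z in Q) (tker alpha e x y)%:E)%E).
    by rewrite integral_cst//= lQ -EFinM mulrC.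
  apply: ge0_le_integral.
  + exact: mQ.
  + by move=> z _; rewrite lee_fin.
  + exact: measurable_cst.
  + by apply: emeasurable_funM; [exact: measurable_cst|exact: mt].
  + move=> z Qz; rewrite -EFinM lee_fin; apply: tker_near => //.
    by rewrite enormC; exact: Qy.
Qed.

Lemma dilation_modulus (e eta : R) : 0 < e -> 0 < eta ->
  exists2 r : R, 0 < r & (1 + r / e) `^ (- g) = 1 + eta.
Proof.
move=> e0 eta0; have p0 : 0 < - g by rewrite oppr_gt0 subr_lt0.
exists (e * ((1 + eta) `^ ((- g)^-1) - 1)).
  rewrite mulr_gt0// subr_gt0.
  have E : (1 : R) `^ ((- g)^-1) = 1 by rewrite powR1.
  rewrite -[ltLHS]E; apply: gt0_ltr_powR; rewrite ?invr_gt0// ?nnegrE ?ltrDl//.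
  by rewrite addr_ge0// ltW.
rewrite mulrAC divff ?gt_eqF// mul1r addrC subrK -powRrM mulVf ?gt_eqF//.
by rewrite powRr1// addr_ge0// ltW.
Qed.

Lemma admissible_discrete l K (d : R) : admissible l K -> 0 < d ->
  exists (e J : nat) (a : nat -> R),
  let T x := \sum_(j < J) a j * tker alpha e.+1%:R^-1 x (ratpt j) in
  [/\ forall j, 0 <= a j,
      forall x, (pot alpha l x <= (T x + d * wt x)%:E)%E,
      forall x, ((T x)%:E <= pot alpha l x + (d * wt x)%:E)%E &
      l setT = (\sum_(j < J) a j)%:E].
Proof.
move=> [cK lK lfin [M' lM'] lnear] d0.
pose M := Num.max M' 0.
have M0 : 0 <= M by rewrite le_max lexx orbT.
have w0 x : 0 < wt x by exact: wt_gt0.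
have lM x : (pot alpha l x <= (M * wt x)%:E)%E.
  by rewrite (le_trans (lM' x))// lee_fin ler_wpM2r ?(ltW (w0 _))// le_max lexx.
have [e ne] := lnear (d / 2) (divr_gt0 d0 (ltr0Sn _ _)).
set e' := e.+1%:R^-1 in ne *.
have e0 : 0 < e' by rewrite invr_gt0.
pose eta := Num.min 1 (d / (4 * (M + 1))).
have eta0 : 0 < eta by rewrite lt_min ltr01 divr_gt0// mulr_gt0// ltr_wpDl.
have etaM : eta * (1 + eta) * M <= d / 2.
  have e1 : eta <= 1 by rewrite ge_min lexx.
  have e2 : eta * (4 * (M + 1)) <= d.
    by rewrite -ler_pdivlMr ?mulr_gt0 ?ltr_wpDl// ge_min lexx orbT.
  rewrite (@le_trans _ _ (eta * 2 * M))//.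
    by rewrite ler_wpM2r// ler_pM2l//; lra.
  by rewrite ler_pdivlMr//; nra.
have [r r0 thE] := dilation_modulus e0 eta0.
have rho0 : 0 < r / n.+1%:R by rewrite divr_gt0.
have [J KJ] := compact_ratpt_cover cK rho0.
pose U j : set B := ball (ratpt j : V) (r / n.+1%:R).
have mU j : measurable (U j) by apply: open_measurable_BV; exact: ball_open.
pose Q := seqDU U.
have mQ j : measurable (Q j) by exact: seqDU_measurable.
have Qr j z : Q j z -> enorm (z - ratpt j) <= r.
  move=> Qz; have := subset_seqDU Qz; rewrite /U mx_norm_ball /ball_/= => zj.
  rewrite enormC (le_trans (enorm_le_mx _))//.
  rewrite (@le_trans _ _ (n.+1%:R * (r / n.+1%:R)))//; last first.
    by rewrite mulrC divfK.
  by apply: ler_pM => //; [rewrite ler_nat|exact: ltW].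
have lQ j : l (Q j) = (fine (l (Q j)))%:E.
  by rewrite fineK// ge0_fin_numE// measure_lty.
pose a j := fine (l (Q j)).
have a0 j : 0 <= a j by exact: fine_ge0.
pose D := \big[setU/set0]_(j < J) Q j.
have mD : measurable D by exact: bigsetU_measurable.
have lD : l (~` D) = 0%E.
  apply/eqP; rewrite eq_le measure_ge0 andbT -lK le_measure ?inE//.
  - exact: measurableC.
  - by apply: measurableC; exact: compact_measurable_BV.
  - by apply: subsetC; rewrite /D -bigsetU_seqDU.
have intD (f : B -> \bar R) : measurable_fun setT f -> (forall z, 0 <= f z)%E ->
    (\int[l]_(z in setT) f z = \sum_(j < J) \int[l]_(z in Q j) f z)%E.
  move=> mf f0; rewrite -(setUv D) ge0_integral_setU//; last 3 first.
  - exact: measurableC.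
  - by rewrite setUv.
  - by rewrite disj_set2E setICr.
  rewrite [X in (_ + X)%E]null_set_integral ?adde0//; last 2 first.
  - exact: measurableC.
  - exact: measurable_funTS.
  have := @ge0_integral_bigsetU _ _ _ l nat Q f (index_iota 0 J) mQ.
  rewrite iota_uniq => /(_ isT) /=; rewrite !big_mkord; apply.
  - by apply: sub_trivIset (trivIset_seqDU U).
  - exact: measurable_funTS.
  - by move=> z _; exact: f0.
exists e, J, a => T.
have TE x : (T x)%:E = (\sum_(j < J) (a j * tker alpha e' x (ratpt j))%:E)%E.
  by rewrite /T sumEFin.
have piece j x := @integral_tker_piece e' r l x (ratpt j) (Q j) (a j) e0 (ltW r0)
  (mQ j) (Qr j) (lQ j).
have t0 x z : (0 <= (tker alpha e' x z)%:E)%E by rewrite lee_fin powR_ge0.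
have tE x := intD _ (measurable_tkerl alpha e' x) (t0 x).
have Tle x : ((T x)%:E <= (1 + eta)%:E * pot alpha l x)%E.
  apply: (@le_trans _ _ ((1 + eta)%:E * \int[l]_(z in setT) (tker alpha e' x z)%:E))%E.
    rewrite tE TE ge0_sume_distrr; last first.
      by move=> j _; apply: integral_ge0 => z _; rewrite lee_fin powR_ge0.
    by apply: lee_sum => j _; rewrite -thE; exact: (piece j x).2.
  by rewrite lee_pmul2l// ?lte_fin ?ltr_wpDr ?(ltW eta0)//; exact: integral_tker_le_pot.
have potE x : exists2 p : R, pot alpha l x = p%:E & 0 <= p <= M * wt x.
  have fp : pot alpha l x \is a fin_num.
    by rewrite ge0_fin_numE ?pot_ge0// (le_lt_trans (lM x))// ltry.
  exists (fine (pot alpha l x)); first by rewrite fineK.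
  by rewrite -!lee_fin fineK// pot_ge0 lM.
split => //.
- move=> x; apply: (le_trans (le_pot_nker_tker _ _ e0)).
  apply: (@le_trans _ _ ((d / 2 * wt x)%:E + ((1 + eta) * T x)%:E)%E).
    apply: leeD; first exact: ne.
    rewrite tE EFinM TE ge0_sume_distrr; last first.
      by move=> j _; rewrite lee_fin mulr_ge0// powR_ge0.
    by apply: lee_sum => j _; rewrite -EFinM -thE; exact: (piece j x).1.
  rewrite -EFinD lee_fin.
  have [p pE /andP[p0 pM]] := potE x.
  have Tp : T x <= (1 + eta) * p by have := Tle x; rewrite pE.
  have : eta * T x <= d / 2 * wt x.
    apply: (@le_trans _ _ (eta * (1 + eta) * M * wt x)); last first.
      by rewrite ler_wpM2r ?(ltW (w0 _)).
    rewrite -!mulrA ler_pM2l// (le_trans Tp)// ler_pM2l// ltr_wpDr ?(ltW eta0)//.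
  by lra.
- move=> x; have [p pE /andP[p0 pM]] := potE x.
  have := Tle x; rewrite pE -EFinM -EFinD !lee_fin => Tp.
  rewrite (le_trans Tp)// mulrDl mul1r lerD2l.
  apply: (@le_trans _ _ (eta * (1 + eta) * M * wt x)).
    rewrite -!mulrA ler_pM2l// (le_trans pM)// ler_peMl ?mulr_ge0 ?(ltW (w0 _))//.
    by rewrite lerDl ltW.
  by rewrite ler_wpM2r ?(ltW (w0 _))// (le_trans etaM)// ler_pdivrMr// ler_peMr ?(ltW d0)// ler1n.
- have := intD (cst 1%E) (measurable_cst _) (fun=> lee01).
  rewrite integral_cst// mul1e => ->; rewrite -sumEFin; apply: eq_bigr => j _.
  by rewrite integral_cst// mul1e lQ.
Qed.

End Discretisation.

Section Separability.
Context {R : realType} {n : nat} (alpha : R).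
Hypothesis alpha_lt_n : alpha < n%:R.
Local Notation V := 'rV[R]_n.
Local Notation B := (BV R n).
Local Notation g := (alpha - n%:R).
Local Notation wt := (wt alpha).
Implicit Types (x y z : V) (nu mu l : meas R n) (K : set V).
Implicit Types t : nat * nat * seq nat.

(* A code [(e, L, s)] stands for the discrete measure with mass [s_j / (L + 1)]
   at the [j]-th rational point, seen through the kernel [tker (1 / (e + 1))]. *)
Definition dpot t x : R := \sum_(j < size t.2)
  (nth 0%N t.2 j)%:R / t.1.2.+1%:R * tker alpha t.1.1.+1%:R^-1 x (ratpt j).

Definition dmass t : R := \sum_(j < size t.2) (nth 0%N t.2 j)%:R / t.1.2.+1%:R.

Definition approx (d : R) t l := [/\
  forall x, (pot alpha l x <= (dpot t x + d * wt x)%:E)%E,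
  forall x, ((dpot t x)%:E <= pot alpha l x + (d * wt x)%:E)%E,
  (l setT <= (dmass t + d)%:E)%E & ((dmass t)%:E <= l setT + d%:E)%E].

Lemma admissible_approx l K (d : R) : admissible alpha l K -> 0 < d ->
  exists t, approx d t l.
Proof.
move=> aK d0; have d2 : 0 < d / 2 by rewrite divr_gt0.
have [e [J [a [a0 Tge Tle lT]]]] := admissible_discrete alpha_lt_n aK d2.
set e' := e.+1%:R^-1 in Tge Tle *.
have e0 : 0 < e' by rewrite invr_gt0.
pose r := \sum_(j < J) enorm (ratpt j : V).
have rj (j : 'I_J) : enorm (ratpt j : V) <= r.
  by rewrite /r (bigD1 j)//= lerDl sumr_ge0// => i _; exact: enorm_ge0.
pose C := (1 + (r + 1) / e') `^ (- g).
have C0 : 0 <= C by exact: powR_ge0.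
pose L := Num.trunc (J%:R * (C + 1) / (d / 2)).
have LJ : J%:R * (C + 1) / L.+1%:R <= d / 2.
  by rewrite ler_pdivrMr// [leRHS]mulrC -ler_pdivrMr// ltW// truncnS_gt.
pose s := mkseq (fun j => Num.trunc (a j * L.+1%:R)) J.
have ds (j : 'I_J) : 0 <= a j - (nth 0%N s j)%:R / L.+1%:R <= L.+1%:R^-1.
  rewrite nth_mkseq//.
  have /truncn_itv/andP[t1 t2] : 0 <= a j * L.+1%:R by rewrite mulr_ge0.
  rewrite subr_ge0 ler_pdivrMr// t1/= lerBlDl -[X in _ + X]mul1r -mulrDl.
  by rewrite ler_pdivlMr// natr1 ltW.
have w0 x : 0 < wt x by exact: wt_gt0.
have sums (h : nat -> R) (c : R) : (forall j : 'I_J, 0 <= h j <= c) ->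
    0 <= \sum_(j < J) (a j - (nth 0%N s j)%:R / L.+1%:R) * h j <=
      J%:R * c / L.+1%:R.
  move=> hc; apply/andP; split.
    apply: sumr_ge0 => j _; apply: mulr_ge0; first by have /andP[] := ds j.
    by have /andP[] := hc j.
  apply: (@le_trans _ _ (\sum_(j < J) L.+1%:R^-1 * c)).
    apply: ler_sum => j _; have /andP[d1 d2'] := ds j; have /andP[h1 h2] := hc j.
    exact: ler_pM.
  by rewrite sumr_const card_ord -[leLHS]mulr_natl mulrCA mulrC.
have dT x : dpot (e, L, s) x = \sum_(j < J) a j * tker alpha e' x (ratpt j) -
    \sum_(j < J) (a j - (nth 0%N s j)%:R / L.+1%:R) * tker alpha e' x (ratpt j).
  rewrite /dpot /= size_mkseq -sumrB; apply: eq_bigr => j _.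
  by rewrite mulrBl opprB addrCA subrr addr0.
have dM : dmass (e, L, s) = \sum_(j < J) a j -
    \sum_(j < J) (a j - (nth 0%N s j)%:R / L.+1%:R) * 1.
  rewrite /dmass /= size_mkseq -sumrB; apply: eq_bigr => j _.
  by rewrite mulr1 opprB addrCA subrr addr0.
have E1 x : 0 <= \sum_(j < J) (a j - (nth 0%N s j)%:R / L.+1%:R) *
    tker alpha e' x (ratpt j) <= d / 2 * wt x.
  have /(sums (fun j => tker alpha e' x (ratpt j)))/andP[-> le2] :
      forall j : 'I_J, 0 <= tker alpha e' x (ratpt j) <= C * wt x.
    by move=> j; rewrite powR_ge0; apply: tker_le_wt.
  rewrite (le_trans le2)// mulrA mulrAC ler_wpM2r ?(ltW (w0 _))//.
  rewrite (le_trans _ LJ)// ler_wpM2r ?invr_ge0//.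
  by rewrite ler_wpM2l// lerDl.
have /andP[E2 E3] : 0 <= \sum_(j < J) (a j - (nth 0%N s j)%:R / L.+1%:R) * 1 <=
    d / 2.
  have /(sums (fun=> 1))/andP[-> le2] : forall j : 'I_J, 0 <= (1 : R) <= 1.
    by move=> j; rewrite ler01 lexx.
  rewrite (le_trans le2)// (le_trans _ LJ)// ler_wpM2r ?invr_ge0//.
  by rewrite ler_wpM2l// lerDr.
exists (e, L, s); split.
- move=> x; rewrite (le_trans (Tge x))// lee_fin dT.
  by have /andP[] := E1 x; lra.
- move=> x; have /andP[E4 E5] := E1 x.
  have := Tle x; set p := pot alpha l x => Tp.
  apply: (@le_trans _ _ (\sum_(j < J) a j * tker alpha e' x (ratpt j))%:E).
    by rewrite lee_fin dT; lra.
  rewrite (le_trans Tp)// leeD2l// lee_fin ler_wpM2r ?(ltW (w0 _))//.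
  by rewrite ler_pdivrMr// ler_peMr ?(ltW d0)// ler1n.
- by rewrite lT dM lee_fin; lra.
- by rewrite lT dM -EFinD lee_fin; lra.
Qed.

Lemma approx_close (d : R) t l l' : approx d t l -> approx d t l' ->
  (forall x, (pot alpha l x <= pot alpha l' x + (2 * d * wt x)%:E)%E) /\
  (l setT <= l' setT + (2 * d)%:E)%E.
Proof.
move=> [l1 _ l3 _] [_ l2 _ l4]; split => [x|].
  rewrite (le_trans (l1 x))// EFinD (le_trans (leeD2r _ (l2 x)))//.
  by rewrite -addeA -EFinD; apply/leeD2l; rewrite lee_fin; lra.
rewrite (le_trans l3)// EFinD (le_trans (leeD2r _ l4))//.
by rewrite -addeA -EFinD; apply/leeD2l; rewrite lee_fin; lra.
Qed.

Lemma Ksigma_dense (A : set V) : exists A' : set V, [/\ A' `<=` A, Ksigma A' &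
  forall l K (d : R), admissible alpha l K -> K `<=` A -> 0 < d ->
  exists l' K', [/\ admissible alpha l' K', K' `<=` A',
    (forall x, (pot alpha l x <= pot alpha l' x + (d * wt x)%:E)%E) /\
      (l setT <= l' setT + d%:E)%E &
    (forall x, (pot alpha l' x <= pot alpha l x + (d * wt x)%:E)%E) /\
      (l' setT <= l setT + d%:E)%E]].
Proof.
pose P (c : nat * (nat * nat * seq nat)) l K :=
  [/\ admissible alpha l K, K `<=` A & approx c.1.+1%:R^-1 c.2 l].
have /choice[F FP] (i : nat) : exists K, [/\ compact K, K `<=` A &
    forall c, unpickle i = Some c -> (exists l K, P c l K) -> exists l, P c l K].
  case: (unpickle i) => [c|]; last by exists set0; split => //; exact: compact0.
  have [[l [K PK]]|H] := pselect (exists l K, P c l K); last first.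
    exists set0; split => //; first exact: compact0.
    by move=> c' [<-].
  exists K; have [[cK _ _ _ _] KA _] := PK; split => // c' [<-] _.
  by exists l.
exists (\bigcup_i F i); split.
- by move=> x [i _ Fx]; have [_ + _] := FP i; exact.
- by exists F; split => // i; have [] := FP i.
move=> l K d aK KA d0; have d2 : 0 < d / 2 by rewrite divr_gt0.
have [m _ /(_ m (leqnn m))/= mr] := near_infty_natSinv_lt (PosNum d2).
have m0 : 0 < m.+1%:R^-1 :> R by rewrite invr_gt0.
have [t lt] := admissible_approx aK m0.
pose c := (m, t).
have [_ _ /(_ c)] := FP (pickle c); rewrite pickleK => /(_ erefl).
case; first by exists l, K.
move=> l' [aK' K'A lt']; exists l', (F (pickle c)).
have md : 2 * m.+1%:R^-1 <= d.
  by rewrite mulrC -ler_pdivlMr// ltW.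
have w0 x : 0 < wt x by exact: wt_gt0.
have close (a b : meas R n) : approx m.+1%:R^-1 t a -> approx m.+1%:R^-1 t b ->
    (forall x, (pot alpha a x <= pot alpha b x + (d * wt x)%:E)%E) /\
      (a setT <= b setT + d%:E)%E.
  move=> ta tb; have [c1 c2] := approx_close ta tb; split => [x|].
    rewrite (le_trans (c1 x))//; apply/leeD2l.
    by rewrite lee_fin ler_wpM2r// ltW.
  by rewrite (le_trans c2)//; apply/leeD2l; rewrite lee_fin.
split => //; [by move=> x Fx; exists (pickle c)|exact: close|exact: close].
Qed.

End Separability.

(** * Inner capacity *)

Lemma le_integral_carried {d} {T : measurableType d} {R : realType}
    (m : {measure set T -> \bar R}) (K : set T) (f h : T -> \bar R) :
  measurable K -> m (~` K) = 0%E ->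
  measurable_fun setT f -> measurable_fun setT h ->
  (forall x, 0 <= f x)%E -> (forall x, 0 <= h x)%E ->
  (forall x, K x -> f x <= h x)%E ->
  (\int[m]_(x in setT) f x <= \int[m]_(x in setT) h x)%E.
Proof.
move=> mK mK0 mf mh f0 h0 fh.
rewrite -(setUv K) ge0_integral_setU//; last 3 first.
- exact: measurableC.
- by rewrite setUv.
- by rewrite disj_set2E setICr.
rewrite [X in (_ + X)%E]null_set_integral ?adde0//; last 2 first.
- exact: measurableC.
- exact: measurable_funTS.
apply: (@le_trans _ _ (\int[m]_(x in K) h x)%E).
  apply: ge0_le_integral => //; exact: measurable_funTS.
by apply: ge0_subset_integral => //; rewrite setUv.
Qed.

Lemma decreasing_almost_uniform {d} {T : measurableType d} {R : realType}
    (m : {measure set T -> \bar R}) (A : set T) (h : nat -> T -> \bar R) :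
  measurable A -> (m A < +oo)%E -> (0 < m A)%E ->
  (forall j, measurable_fun setT (h j)) ->
  (forall x j, h j.+1 x <= h j x)%E ->
  (forall x (e : R), A x -> 0 < e -> exists j, (h j x <= e%:E)%E) ->
  exists A' : set T, [/\ measurable A', A' `<=` A, (0 < m A')%E &
    forall e : R, 0 < e -> exists j, forall x, A' x -> (h j x <= e%:E)%E].
Proof.
move=> mA Afin A0 mh hd hcv; pose c := fine (m A).
have c0 : 0 < c by rewrite fine_gt0// A0.
have c2 : 0 < c / 2 by rewrite divr_gt0.
have mAc : m A = c%:E by rewrite fineK// ge0_fin_numE.
pose S i j := A `&` [set x | (i.+1%:R^-1%:E < h j x)%E].
have mS i j : measurable (S i j).
  apply: measurableI => //; rewrite -[X in measurable X]setTI.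
  exact: emeasurable_fun_o_infty.
have /choice[J JP] i : exists j, (m (S i j) < (c / 2 / (2 ^ i.+1)%:R)%:E)%E.
  apply: (@measure_nonincreasing_lt _ _ _ m (S i)) => //.
  - rewrite (le_lt_trans _ Afin)// le_measure ?inE//; exact: subIsetl.
  - by move=> j x [Ax] /= hx; split => //=; exact: lt_le_trans (hd _ _).
  - rewrite (_ : \bigcap_j _ = set0).
      by rewrite measure0 lte_fin divr_gt0// ltr0n expn_gt0.
    rewrite -subset0 => x Sx; have [Ax _] := Sx 0%N Logic.I.
    have i0 : 0 < i.+1%:R^-1 :> R by rewrite invr_gt0.
    have [j] := hcv x _ Ax i0; have [_ /=] := Sx j Logic.I.
    by rewrite ltNge => /negP.
pose D := \bigcup_i S i (J i).
have mD : measurable D by exact: bigcup_measurable.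
have D2 : (m D <= (c / 2)%:E)%E.
  apply: le_trans (epsilon_trick0 xpredT (ltW c2)).
  apply: (@le_trans _ _ (\sum_(0 <= i <oo) m (S i (J i)))%E).
    exact: measure_sigma_subadditive.
  by apply: lee_nneseries => // i _; apply/ltW; exact: JP.
exists (A `\` D); split.
- exact: measurableD.
- exact: subDsetl.
- rewrite ltNge; apply/negP => AD0.
  have : (m A <= m (A `\` D) + m D)%E.
    rewrite (le_trans _ (measureU2 _ _ _))//; last exact: measurableD.
    rewrite le_measure ?inE//; first by apply: measurableU => //; exact: measurableD.
    by move=> x Ax; have [Dx|Dx] := pselect (D x); [right|left].
  apply/negP; rewrite -ltNge (le_lt_trans (leeD AD0 D2))// add0e mAc lte_fin.
  by rewrite ltr_pdivrMr// ltr_pMr// ltr1n.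
- move=> e e0; have [i _ /(_ i (leqnn i))/= ie] := near_infty_natSinv_lt (PosNum e0).
  exists (J i) => x [Ax Dx]; rewrite leNgt; apply/negP => hx; apply: Dx.
  exists i => //; split => //=; apply: lt_trans hx.
  by rewrite lte_fin.
Qed.

Section Capacity.
Context {R : realType} {n : nat} (alpha : R).
Hypothesis alpha_lt_n : alpha < n%:R.
Local Notation V := 'rV[R]_n.
Local Notation B := (BV R n).
Implicit Types (N : set V) (l : meas R n).

Lemma finite_radon l : (l setT < +oo)%E -> radon l.
Proof.
move=> lfin K cK; rewrite (le_lt_trans _ lfin)// le_measure ?inE//.
exact: compact_measurable_BV.
Qed.

Lemma cap_zero_subset N N' : N `<=` N' -> cap_zero alpha N' -> cap_zero alpha N.
Proof.
move=> NN' /eqP H; apply/eqP; rewrite -leye_eq -(eqP H); apply: le_ereal_inf.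
move=> _ [l [[Ml [El Nl]] l1] <-]; exists l => //; split => //; split => //.
by split => //; apply: negligibleS Nl; exact: subsetC.
Qed.

Lemma cap_zero_null l (M : R) N (E : set B) :
  (l setT < +oo)%E -> (forall x, pot alpha l x <= M%:E)%E ->
  cap_zero alpha N -> measurable E -> E `<=` N -> l E = 0%E.
Proof.
move=> lfin lM N0 mE EN.
apply: contrapT => /eqP lE; have {}lE : (0 < l E)%E by rewrite lt0e lE measure_ge0.
have lEfin : (l E < +oo)%E by exact: measure_lty.
pose c := (fine (l E))^-1.
have fE : 0 < fine (l E) by rewrite fine_gt0// lE.
have c0 : 0 <= c by rewrite invr_ge0 ltW.
pose mu : meas R n := mscale (NngNum c0) (mrestr l mE).
have muE (F : set B) : mu F = (c%:E * l (F `&` E))%E by [].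
have mu1 : mu setT = 1%E.
  rewrite muE setTI -[l E]fineK ?ge0_fin_numE// -EFinM mulVf//.
  by rewrite gt_eqF.
have mufin : (mu setT < +oo)%E by rewrite mu1 ltry.
have potmu x : (pot alpha mu x <= (c * M)%:E)%E.
  rewrite /pot ge0_integral_mscale//; last 2 first.
  - exact: measurable_kappal.
  - by move=> z _; exact: kappa_ge0.
  rewrite EFinM lee_wpmul2l ?lee_fin//; apply: le_trans (lM x).
  apply: pot_le_measure => F mF.
  rewrite /= /mrestr le_measure ?inE//; exact: measurableI.
have energy_mu : (energy alpha mu < +oo)%E.
  apply: (@le_lt_trans _ _ (\int[mu]_(x in setT) (c * M)%:E)%E).
    apply: ge0_le_integral => //.
    - by move=> x _; exact: pot_ge0.
    - by apply: measurable_pot; exact: finite_radon.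
  by rewrite integral_cst// mu1 mule1 ltry.
have : (inv_cap alpha N <= energy alpha mu)%E.
  apply: ereal_inf_lbound; exists mu => //; split => //; split; [|split => //].
  - split; first exact: finite_radon.
    by exists 0; rewrite (le_lt_trans (potmu 0))// ltry.
  - exists (~` E); split; [exact: measurableC| |exact: subsetC].
    by rewrite muE setICl measure0 mule0.
by rewrite N0 leye_eq => /eqP E1; rewrite E1 in energy_mu.
Qed.

End Capacity.

(** * Admissible restrictions of measures of finite energy *)

Lemma negligible_pinfty {d} {T : measurableType d} {R : realType}
    (m : {measure set T -> \bar R}) (f : T -> \bar R) :
  measurable_fun setT f -> (forall x, 0 <= f x)%E ->
  (\int[m]_(x in setT) f x < +oo)%E -> m.-negligible [set x | f x = +oo%E].
Proof.
move=> mf f0 foo; have intf : m.-integrable setT f.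
  apply/integrableP; split => //.
  by under eq_integral do rewrite gee0_abs//.
apply: negligibleS (integrable_ae measurableT intf) => x /= fx.
by move=> /(_ Logic.I); rewrite fx.
Qed.

Section GoodRestriction.
Context {R : realType} {n : nat} (alpha : R).
Hypothesis alpha_lt_n : alpha < n%:R.
Local Notation V := 'rV[R]_n.
Local Notation B := (BV R n).
Local Notation k := (kappa alpha).
Local Notation g := (alpha - n%:R).
Local Notation wt := (wt alpha).
Implicit Types (x y z : V) (N K : set V) (l : meas R n).

Lemma nker_le_kappa e x z : (nker alpha e x z <= k x z)%E.
Proof. by rewrite /nker; case: ifPn => // _; exact: kappa_ge0. Qed.

Lemma nker_mono e e' x z : e <= e' -> (nker alpha e x z <= nker alpha e' x z)%E.
Proof.
move=> ee'; rewrite /nker; case: ltP => [xe|_].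
  by rewrite (lt_le_trans xe ee').
by case: ifPn => // _; exact: kappa_ge0.
Qed.

Lemma integral_nker_small l x (d : R) : (pot alpha l x < +oo)%E -> 0 < d ->
  exists j : nat, (\int[l]_(z in setT) nker alpha j.+1%:R^-1 x z <= d%:E)%E.
Proof.
move=> px d0; apply: contrapT => H.
pose f (j : nat) (z : B) := nker alpha j.+1%:R^-1 x z.
have [|||||_ _ cv] := @dominated_convergence _ B R l setT measurableT
  f (cst 0%E) (fun z : B => k x z).
- by move=> j; exact: measurable_nkerl.
- exact: measurable_cst.
- apply: negligibleS (negligible_pinfty (measurable_kappal alpha x) (kappa_ge0 alpha x) px).
  move=> z /= nz; apply: contrapT => kz; apply: nz => _.
  apply: cvg_near_cst.
  have xz : x != z by apply/eqP => xz; apply: kz; rewrite /kappa xz eqxx.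
  have := near_infty_natSinv_lt (PosNum (enorm_sub_gt0 xz)).
  apply: filterS => j jx; rewrite /f /nker ifF//; apply/negbTE; rewrite -leNgt.
  exact: ltW.
- apply/integrableP; split; first exact: measurable_kappal.
  by under eq_integral do rewrite gee0_abs ?kappa_ge0//.
- apply/aeW => z j _; rewrite gee0_abs ?nker_ge0//; exact: nker_le_kappa.
rewrite integral0 in cv.
have : (d%:E <= limn (fun j => \int[l]_(z in setT) f j z))%E.
  apply: lime_ge; first exact: cvgP cv.
  apply: nearW => j; rewrite leNgt; apply/negP => fj; apply: H; exists j.
  exact: ltW.
by rewrite (cvg_lim _ cv)// lee_fin leNgt d0.
Qed.

(* A nearest point for the sup norm is, up to the factor [n + 1], as close to
   every point of [K] as [x] is: this replaces the maximum principle. *)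
Lemma compact_projection K x : compact K -> K !=set0 ->
  exists2 x', K x' & forall z, K z -> enorm (x' - z) <= n.+1%:R * enorm (x - z).
Proof.
move=> cK K0.
have cf : continuous (fun y : V => `|x - y|).
  move=> y; apply: (@continuous_comp _ _ _ (fun y : V => x - y) Num.norm).
    by apply: continuousB; [exact: cst_continuous|move=> ?; exact].
  exact: norm_continuous.
have [x' Kx' x'P] := compact_EVT_min K0 cK (continuous_subspaceT cf).
exists x'; first exact: set_mem.
move=> z Kz; rewrite (le_trans (enorm_dist x _ _))// -natr1 mulrDl mul1r.
rewrite lerD2r enormC (le_trans (enorm_le_mx _))// ler_wpM2l//.
by rewrite (le_trans (x'P z (mem_set Kz)))// mx_le_enorm.
Qed.

Section Restriction.
Variables (l0 : meas R n) (K : set V) (r : R).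
Hypothesis l0_fin : (l0 setT < +oo)%E.
Hypothesis cK : compact K.
Hypothesis Kr : forall z, K z -> enorm z <= r.
Let mK : measurable (K : set B) := compact_measurable_BV cK.
Let l : meas R n := mrestr l0 mK.

Let lK0 : l (~` K) = 0%E.
Proof. by rewrite /l /= /mrestr setICl measure0. Qed.

Let lmono (f : B -> \bar R) : measurable_fun setT f -> (forall z, 0 <= f z)%E ->
  (\int[l]_(z in setT) f z <= \int[l0]_(z in setT) f z)%E.
Proof.
move=> mf f0; apply: ge0_le_measure_integral => // S mS.
by rewrite /l /= /mrestr le_measure ?inE//; exact: measurableI.
Qed.

Lemma restriction_nker_le (e b : R) : 0 < e <= 1 -> 0 <= b ->
  (forall x', K x' ->
    \int[l0]_(z in setT) nker alpha (n.+1%:R * e) x' z <= b%:E)%E ->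
  forall x, (\int[l]_(z in setT) nker alpha e x z <=
    (n.+1%:R `^ (- g) * b / (`|r| + 1) `^ g * wt x)%:E)%E.
Proof.
move=> /andP[e0 e1] b0 Hb x; set C := n.+1%:R `^ (- g).
have C0 : 0 < C by rewrite powR_gt0.
have w1 : 0 < (`|r| + 1) `^ g by rewrite powR_gt0// ltr_wpDl.
have mnk e' y := measurable_nkerl alpha e' y.
have nk0 e' y z := nker_ge0 alpha e' y z.
have [[z0 Kz0 z0e]|H] := pselect (exists2 z, K z & enorm (x - z) < e); last first.
  apply: (@le_trans _ _ (\int[l]_(z in setT) cst 0%E z)%E).
    apply: (le_integral_carried mK) => // z Kz; rewrite /nker ifF//.
    by apply/negP => xz; apply: H; exists z.
  by rewrite integral0 lee_fin mulr_ge0 ?(ltW (wt_gt0 _ _))// divr_ge0 ?mulr_ge0// ltW.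
have [x' Kx' x'P] := compact_projection x cK (ex_intro _ z0 Kz0).
have c0 : 0 < n.+1%:R :> R by [].
have wx : (`|r| + 1) `^ g <= wt x.
  rewrite /wt /tker subr0; apply: powR_anti => //.
    by rewrite lt_max ltr01 orbT.
  rewrite ge_max lerDr normr_ge0 andbT.
  rewrite -[x](subrK z0) (le_trans (enormD _ _))// addrC lerD//.
    exact: le_trans (Kr Kz0) (ler_norm _).
  by rewrite (le_trans (ltW z0e)).
apply: (@le_trans _ _ (C%:E * b%:E)%E); last first.
  rewrite -EFinM lee_fin -[leLHS]mulr1 -!mulrA ler_pM2l// ler_wpM2l//.
  by rewrite mulrC ler_pdivlMr// mul1r.
apply: (@le_trans _ _ (\int[l]_(z in setT)
    (C%:E * nker alpha (n.+1%:R * e) x' z))%E).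
  apply: (le_integral_carried mK) => //.
  - by apply: emeasurable_funM => //; exact: measurable_cst.
  - by move=> z; rewrite mule_ge0// lee_fin ltW.
  - by move=> z Kz; apply: nker_dilation => //; exact: x'P.
rewrite ge0_integralZl//; last by rewrite lee_fin ltW.
rewrite lee_pmul2l// ?lte_fin//; apply: le_trans (Hb _ Kx').
exact: lmono.
Qed.

Lemma restriction_admissible (M : R) : 0 <= M ->
  (forall x', K x' -> pot alpha l0 x' <= M%:E)%E ->
  (forall d : R, 0 < d -> exists j : nat, forall x', K x' ->
    (\int[l0]_(z in setT) nker alpha j.+1%:R^-1 x' z <= d%:E)%E) ->
  admissible alpha l K.
Proof.
move=> M0 HM Hd.
have lfin : (l setT < +oo)%E by rewrite /l /= /mrestr setTI measure_lty.
have w1 : 0 < (`|r| + 1) `^ g by rewrite powR_gt0// ltr_wpDl.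
have C0 : 0 < n.+1%:R `^ (- g) :> R by rewrite powR_gt0.
split => //.
- pose C := (1 + (`|r| + 1) / 1) `^ (- g).
  have lT : l setT = (fine (l setT))%:E by rewrite fineK// ge0_fin_numE.
  exists (n.+1%:R `^ (- g) * M / (`|r| + 1) `^ g + C * fine (l setT)) => x.
  rewrite (le_trans (le_pot_nker_tker alpha l x ltr01))// mulrDl EFinD leeD//.
    apply: restriction_nker_le => //; first by rewrite ltr01 lexx.
    move=> x' Kx'; apply: le_trans (HM _ Kx').
    apply: ge0_le_integral => //.
    + by move=> z _; exact: nker_ge0.
    + exact: measurable_nkerl.
    + exact: measurable_kappal.
    + by move=> z _; exact: nker_le_kappa.
  apply: (@le_trans _ _ (\int[l]_(z in setT) (C * wt x)%:E)%E).
    apply: (le_integral_carried mK) => //.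
    + exact: measurable_tkerl.
    + by move=> z; rewrite lee_fin powR_ge0.
    + by move=> z; rewrite lee_fin mulr_ge0 ?powR_ge0.
    + move=> z Kz; rewrite lee_fin; apply: tker_le_wt => //.
      exact: le_trans (Kr Kz) (ler_norm _).
  by rewrite integral_cst// lT -EFinM lee_fin mulrAC.
- move=> d d0; pose b := d * (`|r| + 1) `^ g / n.+1%:R `^ (- g).
  have b0 : 0 < b by rewrite divr_gt0// mulr_gt0.
  have [j jb] := Hd b b0; exists (n.+1 * j.+1).-1 => x.
  rewrite prednK ?muln_gt0// natrM.
  apply: le_trans (@restriction_nker_le (n.+1%:R * j.+1%:R)^-1 b _ (ltW b0) _ x) _.
  - by rewrite invr_gt0 mulr_gt0//= invf_le1 ?mulr_gt0// -natrM ler1n muln_gt0.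
  - by move=> x' Kx'; rewrite invfM mulrA divff// mul1r; exact: jb.
  - rewrite lee_fin ler_wpM2r ?(ltW (wt_gt0 _ _))// /b mulrC.
    rewrite [n.+1%:R `^ _ * _]mulrC divfK ?gt_eqF//.
    by rewrite mulrC mulfK ?gt_eqF.
Qed.

End Restriction.

Lemma cap_pos_admissible N (E : nat -> set B) :
  (forall m, measurable (E m)) -> N `<=` \bigcup_m E m -> ~ cap_zero alpha N ->
  exists l K m, [/\ admissible alpha l K, K `<=` N, K `<=` E m &
    (0 < l setT)%E].
Proof.
move=> mE NE capN.
have [l0 [[Ml0 [El0 Nl0]] l01]] : exists l0 : meas R n,
    Eplus alpha N l0 /\ l0 (setT : set B) = 1%E.
  apply: contrapT => H; apply: capN; rewrite /cap_zero /inv_cap.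
  rewrite (_ : [set energy alpha mu | mu in _] = set0) ?ereal_inf0//.
  by apply/seteqP; split => // e [l0 Pl0 _]; case: H; exists l0.
have l0fin : (l0 setT < +oo)%E by rewrite l01 ltry.
have [rl0 _] := Ml0.
have mp : measurable_fun setT (pot alpha l0 : B -> \bar R).
  exact: measurable_pot.
have poo := negligible_pinfty mp (pot_ge0 alpha l0) El0.
have [Z [mZ Z0 NZ]] := Nl0.
pose P (m : nat) : set B := [set x | (pot alpha l0 x <= m%:R%:E)%E].
have mP m : measurable (P m).
  rewrite -[P m]setTI; exact: emeasurable_fun_infty_c.
have [m [m' A0]] : exists m m', (0 < l0 (~` Z `&` (E m `&` P m')))%E.
  apply: contrapT => H.
  pose W := Z `|` ([set x | pot alpha l0 x = +oo%E] `|`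
      \bigcup_m \bigcup_m' (~` Z `&` (E m `&` P m'))).
  have NW : l0.-negligible W.
    apply: negligibleU; first exact/negligibleP.
    apply: negligibleU => //.
    apply: negligible_bigcup => m; apply: negligible_bigcup => m'.
    apply/negligibleP; first by apply: measurableI; [exact: measurableC|exact: measurableI].
    apply/eqP; rewrite eq_le measure_ge0 andbT leNgt; apply/negP => A0; apply: H.
    by exists m, m'.
  have WT : (setT : set B) `<=` W; last first.
    have T0 : l0 (setT : set B) = 0%E.
      by apply: (negligibleP _ measurableT).1; exact: negligibleS NW.
    have : (1 : \bar R)%E = 0%E by rewrite -l01; exact: T0.
    by move=> [] /eqP; rewrite oner_eq0.
  move=> x _; have [Zx|Zx] := pselect (Z x); first by left.
  right; have [px|px] := pselect (pot alpha l0 x = +oo%E); first by left.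
  have Nx : N x by apply: contrapT => Nx; exact/Zx/NZ.
  have [m _ Ex] := NE _ Nx; right; exists m => //.
  have px' : pot alpha l0 x \is a fin_num.
    by rewrite ge0_fin_numE ?pot_ge0// ltey; apply/eqP.
  exists (Num.trunc (fine (pot alpha l0 x))).+1 => //; split => //; split => //.
  by rewrite /P /= -[leLHS]fineK// lee_fin ltW// truncnS_gt.
set A := ~` Z `&` (E m `&` P m') in A0.
have mA : measurable A by apply: measurableI; [exact: measurableC|exact: measurableI].
have [|||A' [mA' A'A A'0 A'u]] := @decreasing_almost_uniform _ B R l0 A
  (fun j x => \int[l0]_(z in setT) nker alpha j.+1%:R^-1 x z)%E mA
  (measure_lty l0fin mA) A0.
- move=> j; apply: (@measurable_kernel_integral _ B R (nker alpha j.+1%:R^-1) l0).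
  + exact: radon_sigma_finite.
  + by apply: (@measurable_nker R n alpha _ (B * B)%type _ fst snd).
  + exact: nker_ge0.
- move=> x j; apply: ge0_le_integral => //.
  + by move=> z _; exact: nker_ge0.
  + exact: measurable_nkerl.
  + exact: measurable_nkerl.
  + move=> z _; apply: nker_mono; rewrite lef_pV2 ?posrE ?ltr0Sn//.
    by rewrite ler_nat.
- move=> x d [_ [_ Px]] d0; apply: integral_nker_small => //.
  by rewrite (le_lt_trans Px)// ltry.
have [K [cK KA' K0]] := inner_regular_pos l0fin mA' A'0.
have KA x : K x -> A x by move=> /KA' /A'A.
have [r Kr] : exists r, forall z, K z -> enorm z <= r.
  have [M [_ /(_ (M + 1)) MK]] := compact_bounded cK.
  exists (n%:R * (M + 1)) => z Kz; rewrite (le_trans (enorm_le_mx _))//.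
  by rewrite ler_wpM2l// MK// ltrDl.
exists (mrestr l0 (compact_measurable_BV cK)), K, m; split.
- apply: (restriction_admissible l0fin cK Kr (ler0n _ m')).
    by move=> x' /KA [_ []].
  by move=> d /A'u [j jd]; exists j => x' Kx'; apply: jd; exact: KA'.
- by move=> x /KA [Zx _]; apply: contrapT => Nx; exact/Zx/NZ.
- by move=> x /KA [_ []].
- by rewrite /= /mrestr setTI.
Qed.

End GoodRestriction.

(** * Transfer of inequalities holding nearly everywhere *)

Section Transfer.
Context {R : realType} {n : nat} (alpha : R).
Hypothesis alpha_lt_n : alpha < n%:R.
Local Notation V := 'rV[R]_n.
Local Notation B := (BV R n).
Local Notation wt := (wt alpha).
Implicit Types (x y z : V) (A : set V) (l nu tau : meas R n).

Definition dominated (d : R) l l' :=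
  (forall x, (pot alpha l x <= pot alpha l' x + (d * wt x)%:E)%E) /\
  (l setT <= l' setT + d%:E)%E.

Definition tame (f : V -> \bar R) := [/\
  measurable_fun setT (f : B -> \bar R), forall x, (0 <= f x)%E &
  exists2 C : R, 0 <= C & forall l l' d, (l setT < +oo)%E -> (l' setT < +oo)%E ->
    0 < d -> dominated d l l' ->
    (\int[l]_(x in setT) f x <= \int[l']_(x in setT) f x + (d * C)%:E)%E].

Lemma tame1 : tame (fun=> 1%E).
Proof.
split=> //; exists 1 => // l l' d _ _ _ [_ ll'].
by rewrite !integral_cst// !mul1e mulr1.
Qed.

Lemma tame_pot tau : Mplus alpha tau -> tame (pot alpha tau).
Proof.
move=> Mt; have [rt _] := Mt.
have wfin := integral_wt_lty alpha_lt_n Mt.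
have w0 : (0 <= \int[tau]_(x in setT) (wt x)%:E)%E.
  by apply: integral_ge0 => x _; rewrite lee_fin powR_ge0.
set W := (\int[tau]_(x in setT) (wt x)%:E)%E in wfin w0.
have WE : W = (fine W)%:E by rewrite fineK// ge0_fin_numE.
split; [exact: measurable_pot|exact: pot_ge0|].
exists (fine W) => [|l l' d lfin l'fin d0 [ll' _]]; first exact: fine_ge0.
rewrite integral_potC//; last exact: finite_radon.
rewrite [X in (_ <= X + _)%E]integral_potC//; last exact: finite_radon.
have mw : measurable_fun setT (fun x : B => (d * wt (x : V))%:E).
  rewrite (_ : (fun _ => _) = fun x : B => (d%:E * (wt (x : V))%:E)%E)//.
  by apply: emeasurable_funM; [exact: measurable_cst|exact: measurable_wt].
have dw x : (0 <= (d * wt x)%:E)%E by rewrite lee_fin mulr_ge0 ?powR_ge0// ltW.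
have dW : (\int[tau]_(x in setT) (d * wt x)%:E = (d * fine W)%:E)%E.
  rewrite [RHS]EFinM -WE; under eq_integral do rewrite EFinM.
  rewrite ge0_integralZl//; first exact: measurable_wt.
  - by move=> x _; rewrite lee_fin powR_ge0.
  - by rewrite lee_fin ltW.
apply: (@le_trans _ _ (\int[tau]_(x in setT)
    (pot alpha l' x + (d * wt x)%:E))%E).
  apply: ge0_le_integral => //.
  - by move=> x _; exact: pot_ge0.
  - by apply: measurable_pot; exact: finite_radon.
  - by apply: emeasurable_funD => //; apply: measurable_pot; exact: finite_radon.
rewrite ge0_integralD//; last 2 first.
- by move=> x _; exact: pot_ge0.
- by apply: measurable_pot; exact: finite_radon.
by rewrite dW.
Qed.

Lemma admissible_integral_pot l (K : set V) tau :
  admissible alpha l K -> Mplus alpha tau ->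
  (\int[l]_(x in setT) pot alpha tau x < +oo)%E.
Proof.
move=> [_ _ lfin [M lM] _] Mt; have [rt _] := Mt.
rewrite integral_potC//; last exact: finite_radon.
pose M' := Num.max M 0.
apply: (@le_lt_trans _ _ (\int[tau]_(x in setT) (M'%:E * (wt x)%:E))%E).
  apply: ge0_le_integral => //.
  - by move=> x _; exact: pot_ge0.
  - by apply: measurable_pot; exact: finite_radon.
  - by apply: emeasurable_funM; [exact: measurable_cst|exact: measurable_wt].
  - move=> x _; rewrite (le_trans (lM x))// -EFinM lee_fin.
    by rewrite ler_wpM2r ?powR_ge0// le_max lexx.
rewrite ge0_integralZl//; last 3 first.
- exact: measurable_wt.
- by move=> x _; rewrite lee_fin powR_ge0.
- by rewrite lee_fin le_max lexx orbT.
rewrite lte_mul_pinfty ?lee_fin//; first by rewrite le_max lexx orbT.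
exact: integral_wt_lty.
Qed.

Lemma ne_on_subset A A' (P : V -> Prop) : A' `<=` A ->
  ne_on alpha A P -> ne_on alpha A' P.
Proof.
move=> A'A [N [NA [N0 NP]]]; exists (N `&` A'); split; first by move=> x [].
split; first by apply: cap_zero_subset N0 => x [].
by move=> x A'x Nx; apply: NP; [exact: A'A|move=> Nx'; exact: Nx].
Qed.

Lemma ne_on_transfer A A' (f : V -> \bar R) nu : Mplus alpha nu -> tame f ->
  (forall l K (d : R), admissible alpha l K -> K `<=` A -> 0 < d ->
    exists l' K', [/\ admissible alpha l' K', K' `<=` A',
      dominated d l l' & dominated d l' l]) ->
  ne_on alpha A' (fun x => (f x <= pot alpha nu x)%E) ->
  ne_on alpha A (fun x => (f x <= pot alpha nu x)%E).
Proof.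
move=> Mnu [mf f0 [C2 C20 fC2]] dense [N' [N'A' [N'0 N'P]]].
have [mu u0 [C1 C10 uC1]] := tame_pot Mnu.
set u := pot alpha nu in N'P mu u0 uC1 *.
exists [set x | A x /\ ~ (f x <= u x)%E]; split; first by move=> x [].
split; last by move=> x Ax Nx; apply: contrapT => fu; exact: Nx.
apply: contrapT => capN.
pose E (m : nat) : set B := [set x | (u x + m.+1%:R^-1%:E <= f x)%E].
have mE m : measurable (E m).
  rewrite -[E m]setTI; apply: measurable_lee => //.
  by apply: emeasurable_funD => //; exact: measurable_cst.
have NE : [set x | A x /\ ~ (f x <= u x)%E] `<=` \bigcup_m E m.
  move=> x [Ax /negP]; rewrite -ltNge => uf.
  have ux : u x \is a fin_num by rewrite ge0_fin_numE// (lt_le_trans uf)// leey.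
  rewrite -(fineK ux) in uf.
  move: uf; case fx : (f x) => [r| |]; last by rewrite ltNge leNye.
  - rewrite lte_fin -subr_gt0 => uf.
    have [m _ /(_ m (leqnn m))/= mr] := near_infty_natSinv_lt (PosNum uf).
    exists m => //; rewrite /E /= fx -(fineK ux) -EFinD lee_fin addrC.
    by rewrite -lerBrDr ltW.
  - by move=> _; exists 0%N => //; rewrite /E /= fx leey.
have [l [K [m [al KN KE lpos]]]] := cap_pos_admissible alpha_lt_n mE NE capN.
have [cK lK lfin _ _] := al.
pose eta : R := m.+1%:R^-1; have eta0 : 0 < eta by rewrite invr_gt0.
pose L := fine (l setT).
have LE : l setT = L%:E by rewrite fineK// ge0_fin_numE.
have L0 : 0 < L by rewrite fine_gt0// lpos.
pose d := eta * L / (C1 + C2 + 1).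
have C0 : 0 < C1 + C2 + 1 by rewrite ltr_wpDl// addr_ge0.
have d0 : 0 < d by rewrite divr_gt0// mulr_gt0.
have KA : K `<=` A by move=> x /KN [].
have [l' [K' [al' K'A' ll' l'l]]] := dense l K d al KA d0.
have [cK' lK' l'fin [M lM] _] := al'.
have mK' := compact_measurable_BV cK'.
pose S : set B := K' `&` [set x | (u x < f x)%E].
have mS : measurable S.
  apply: measurableI => //; rewrite -[X in measurable X]setTI.
  exact: measurable_lte.
have lM0 x : (pot alpha l' x <= (Num.max M 0)%:E)%E.
  rewrite (le_trans (lM x))// lee_fin.
  rewrite (@le_trans _ _ (Num.max M 0 * wt x))//.
    by rewrite ler_wpM2r ?powR_ge0// le_max lexx.
  by rewrite ler_piMr ?wt_le1// le_max lexx orbT.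
have S0 : l' S = 0%E.
  apply: (cap_zero_null l'fin lM0 N'0 mS) => x [K'x /=].
  by rewrite ltNge => /negP uf; apply: contrapT => N'x; apply/uf/N'P => //; exact: K'A'.
have l'fu : (\int[l']_(x in setT) f x <= \int[l']_(x in setT) u x)%E.
  apply: (@le_integral_carried _ B R l' (K' `\` S)) => //.
  - exact: measurableD.
  - apply/eqP; rewrite eq_le measure_ge0 andbT.
    rewrite (_ : ~` _ = ~` K' `|` S); last first.
      by rewrite setDE setCI setCK.
    have le0 (a b : \bar R) : a = 0%E -> b = 0%E -> (a + b <= 0)%E.
      by move=> -> ->; rewrite adde0.
    exact: le_trans (measureU2 _ (measurableC mK') mS) (le0 _ _ lK' S0).
  - move=> x [K'x Sx]; rewrite leNgt; apply/negP => uf; exact: Sx.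
have lower : (\int[l]_(x in setT) u x + (eta * L)%:E <= \int[l]_(x in setT) f x)%E.
  have -> : ((eta * L)%:E = \int[l]_(x in setT) (cst eta%:E x))%E.
    by rewrite integral_cst// LE.
  rewrite -ge0_integralD//; last by move=> x _; rewrite lee_fin ltW.
  apply: (@le_integral_carried _ B R l K) => //.
  - exact: compact_measurable_BV.
  - by apply: emeasurable_funD => //; exact: measurable_cst.
  - by move=> x; rewrite adde_ge0// lee_fin ltW.
have ufin := admissible_integral_pot al Mnu.
have u_fin : (\int[l]_(x in setT) u x)%E \is a fin_num.
  by rewrite ge0_fin_numE// integral_ge0.
have : (\int[l]_(x in setT) u x + (eta * L)%:E <=
    \int[l]_(x in setT) u x + (d * C1 + d * C2)%:E)%E.
  apply: (le_trans lower); apply: (le_trans (fC2 l l' d lfin l'fin d0 ll')).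
  rewrite EFinD addeA; apply: leeD2r; apply: (le_trans l'fu).
  exact: uC1.
rewrite leeD2lE// lee_fin -mulrDr /d mulrAC ler_pdivlMr//.
by have := mulr_gt0 eta0 L0; nra.
Qed.

End Transfer.

Theorem mainTheorem18 (R : realType) (n : nat) (alpha : R)
  (hn : (3 <= n)%N) (halpha0 : 0 < alpha) (halpha2 : alpha <= 2)
  (A : set 'rV[R]_n) :
  thin_at_infinity alpha A ->
  exists A' : set 'rV[R]_n,
    [/\ A' `<=` A, Ksigma A',
        exists g, is_equilibrium alpha A g /\ is_equilibrium alpha A' g
      & regular_pts alpha A = regular_pts alpha A'].
Proof.
move=> [g eqA].
have alpha_lt_n : alpha < n%:R.
  by rewrite (le_lt_trans halpha2)// ltr_nat.
have [A' [A'A KA' dense]] := Ksigma_dense alpha_lt_n A.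
have neE (f : 'rV[R]_n -> \bar R) : tame alpha f ->
    [set nu | Mplus alpha nu /\ ne_on alpha A (fun y => (f y <= pot alpha nu y)%E)] =
    [set nu | Mplus alpha nu /\ ne_on alpha A' (fun y => (f y <= pot alpha nu y)%E)].
  move=> tf; apply/seteqP; split => nu [Mnu nenu]; split => //.
    exact: ne_on_subset nenu.
  exact: ne_on_transfer nenu.
exists A'; split => //.
- exists g; split => //; have [Mg gE] := eqA; split => // x.
  by rewrite gE neE//; exact: tame1.
- have n0 : (0 < n)%N by exact: leq_trans hn.
  apply/seteqP; split => y [My yE]; split => // x; rewrite yE neE//.
    by apply: tame_pot => //; exact: Mplus_dirac.
  by apply: tame_pot => //; exact: Mplus_dirac.
Qed.
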